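(* Let $X$ be an infinite-dimensional Fréchet space over $\mathbb{K}\in\{\mathbb{R},\mathbb{C}\}$, let $(p_j)_{j\in\mathbb{N}}$ be a separating increasing sequence of seminorms inducing the topology of $X$, let $d(x,y)=\sum_{j=1}^\infty 2^{-j}\min(1,p_j(x-y))$, and let $T\colon X\to X$ be a continuous linear operator. Then the following assertions are equivalent: (1) $T$ admits a dense set of semi-irregular vectors; (2) $T$ admits a residual set of $m$-irregular vectors for some $m\in\mathbb{N}$; (3) there exists $m\in\mathbb{N}$ such that for every sequence $(O_j)_{j\in\mathbb{N}}$ of nonempty open subsets of $X$, there exists a sequence $(K_j)_{j\in\mathbb{N}}$ of Cantor sets with $K_j\subset O_j$ such that $\bigcup_{j=1}^\infty K_j$ is Li-Yorke $m$-extremely scrambled; (4) the proximal relation of $T$ is dense in $X\times X$ and $T$ is sensitive; (5) the proximal cell of $\mathbf{0}$ is dense in $X$ and there exists $x\in X$ such that $\limsup_{n\to\infty}d(T^nx,\mathbf{0})>0$.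
   Context: $\mathbb{N}$ is the set of positive integers and $\mathbf 0$ is the zero vector of $X$. A set is residual if it contains a dense $G_\delta$ subset. A Cantor set is a subset homeomorphic to the Cantor ternary set. A vector $x\in X$ is semi-irregular for $T$ if $\liminf_{n\to\infty} d(T^nx,\mathbf 0)=0$ and $\limsup_{n\to\infty} d(T^nx,\mathbf 0)>0$. For $m\in\mathbb{N}$, $x$ is $m$-irregular for $T$ if $\liminf_{n\to\infty} d(T^nx,\mathbf 0)=0$ and $\limsup_{n\to\infty} p_m(T^nx)=\infty$. A pair $(x,y)\in X\times X$ is Li-Yorke $m$-extremely chaotic if $\liminf_{n\to\infty}d(T^nx,T^ny)=0$ and $\limsup_{n\to\infty}p_m(T^nx-T^ny)=\infty$. A set $K\subset X$ is Li-Yorke $m$-extremely scrambled if any two distinct points of $K$ form a Li-Yorke $m$-extremely chaotic pair. A pair $(x,y)$ is proximal if $\liminf_{n\to\infty}d(T^nx,T^ny)=0$; the proximal relation is the set of proximal pairs; the proximal cell of $\mathbf 0$ is $\{y\in X:(\mathbf 0,y)\text{ is proximal}\}$. $T$ is sensitive if there exists $\delta>0$ such that for every $x\in X$ and $\varepsilon>0$ there exist $y\in X$ with $d(x,y)<\varepsilon$ and $n\in\mathbb{N}$ such that $d(T^nx,T^ny)>\delta$. *)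

(* Defs.v *)
From HB Require Import structures.
From mathcomp Require Import all_boot all_order all_algebra.
From mathcomp Require Import all_classical all_reals all_analysis borel_hierarchy.
From mathcomp Require Import complex.

Set Implicit Arguments.
Unset Strict Implicit.
Unset Printing Implicit Defensive.

Import Order.TTheory GRing.Theory Num.Theory.
Import numFieldNormedType.Exports.

Local Open Scope classical_set_scope.
Local Open Scope ring_scope.

Inductive scalar_kind := RealScalars | ComplexScalars.

Definition scalars (R : realType) (k : scalar_kind) : numFieldType :=
  match k with
  | RealScalars => R
  | ComplexScalars => R[i]
  end.

(* The norm of R[i] takes its values in R[i]; its real part is the modulus. *)
Definition modulus (R : realType) (k : scalar_kind) : scalars R k -> R :=
  match k return scalars R k -> R with
  | RealScalars => fun a : R => `|a|
  | ComplexScalars => fun a : R[i] => complex.Re `|a|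
  end.

Definition infinite_dimensional (K : numFieldType) (X : lmodType K) :=
  ~ exists (n : nat) (v : 'I_n -> X),
      forall x : X, exists c : 'I_n -> K, x = \sum_(i < n) c i *: v i.

(* A sequence (p_j)_{j >= 1} is encoded with a shift: [p j] stands for
   p_{j+1}, whence the weight 2^-(j+1) below. *)
Definition frechet_dist (R : realType) (X : zmodType) (p : nat -> X -> R)
    (x y : X) : R :=
  limn (series (fun j => 2 ^- j.+1 * Num.min 1 (p j (x - y)))).

Section frechet.
Context (R : realType) (k : scalar_kind) (X : tvsType (scalars R k)).
Implicit Types (p : nat -> X -> R) (q : X -> R).

Definition seminorm q :=
  [/\ forall x, 0 <= q x,
      forall x y, q (x + y) <= q x + q y &
      forall (a : scalars R k) x, q (a *: x) = modulus a * q x].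

Definition separating p := forall x, (forall j, p j x = 0) -> x = 0.

Definition induces_topology p := forall (x : X) (U : set X),
  nbhs x U <-> exists (n : nat) (e : R), 0 < e /\
    [set y | forall j, (j <= n)%N -> p j (x - y) < e] `<=` U.

(* Completeness is stated with the distance because the uniform structure
   carried by a [tvsType] need not be the one given by its additive group. *)
Definition dist_complete p := forall u : nat -> X,
  (forall e : R, 0 < e -> exists N : nat, forall m n : nat,
     (N <= m)%N -> (N <= n)%N -> frechet_dist p (u m) (u n) < e) ->
  exists l : X, u @ \oo --> l.

Definition frechet_space p :=
  [/\ forall j, seminorm (p j),
      forall j x, p j x <= p j.+1 x,
      separating p,
      induces_topology p &
      dist_complete p].

End frechet.

Definition residual (X : topologicalType) (A : set X) :=
  exists G : set X, [/\ Gdelta G, dense G & G `<=` A].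

Definition homeomorphic_sets (S T : topologicalType) (A : set S) (B : set T) :=
  exists (f : S -> T) (g : T -> S),
    [/\ f @` A = B,
        forall x, A x -> g (f x) = x,
        {within A, continuous f} &
        {within B, continuous g}].

(* The reals with a ternary expansion that uses only the digits 0 and 2. *)
Definition cantor_ternary (R : realType) : set R :=
  range (fun a : nat -> bool =>
    limn (series (fun n => (2 * (a n)%:R) / 3 ^+ n.+1 : R))).

Definition cantor_set (R : realType) (X : topologicalType) (K : set X) :=
  homeomorphic_sets (@cantor_ternary R) K.

Section dynamics.
Context (R : realType) (X : zmodType) (p : nat -> X -> R) (T : X -> X).
Local Notation d := (frechet_dist p).

Definition semi_irregular (x : X) :=
  limn_einf (fun n => (d (iter n T x) 0)%:E) = 0%E /\
  (0 < limn_esup (fun n => (d (iter n T x) 0)%:E))%E.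

Definition irregular (m : nat) (x : X) :=
  limn_einf (fun n => (d (iter n T x) 0)%:E) = 0%E /\
  limn_esup (fun n => (p m (iter n T x))%:E) = +oo%E.

Definition proximal (x y : X) :=
  limn_einf (fun n => (d (iter n T x) (iter n T y))%:E) = 0%E.

Definition li_yorke_extremely_chaotic (m : nat) (x y : X) :=
  limn_einf (fun n => (d (iter n T x) (iter n T y))%:E) = 0%E /\
  limn_esup (fun n => (p m (iter n T x - iter n T y))%:E) = +oo%E.

Definition li_yorke_extremely_scrambled (m : nat) (K : set X) :=
  forall x y, K x -> K y -> x <> y -> li_yorke_extremely_chaotic m x y.

Definition proximal_relation : set (X * X) :=
  [set xy | proximal xy.1 xy.2].

Definition proximal_cell (x : X) : set X := [set y | proximal x y].

Definition sensitive :=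
  exists2 delta : R, 0 < delta &
    forall (x : X) (e : R), 0 < e ->
      exists (y : X) (n : nat),
        [/\ d x y < e, (0 < n)%N & delta < d (iter n T x) (iter n T y)].

End dynamics.

(* Main.v *)
Require Import Defs.
From mathcomp Require Import all_boot all_order all_algebra.
From mathcomp Require Import all_classical all_reals all_analysis.
From mathcomp Require Import complex lra zify.

Set Implicit Arguments.
Unset Strict Implicit.
Unset Printing Implicit Defensive.

Import Order.TTheory GRing.Theory Num.Theory.
Import numFieldNormedType.Exports.

Local Open Scope classical_set_scope.
Local Open Scope ring_scope.

(**
Write N x for the distance of x to 0. It is a complete translation invariant
F-norm, and its balls define the topology, so that Baire's theorem holds
([baire]). By linearity every condition on a pair (x, y) is a condition on the
orbit of x - y. Two families of open sets describe these orbits: [near_zero n],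
whose intersection over n consists of the vectors proximal to 0, and
[large m n], whose intersection over n consists of the vectors with
limsup p_m(T^n x) infinite.

(1) implies (2). Let x be one semi-irregular vector. If some [large m n] were
not dense, the iterates of index at least n would be bounded in p_m on a ball,
hence by scaling uniformly small in p_m near 0. As the orbit of x enters every
neighbourhood of 0, it would stay small in p_m from then on, and if m is chosen
large enough for the limsup of N along the orbit of x, this is a contradiction
([large_dense]). So the sets [near_zero n] and [large m n] are open and dense,
and Baire's theorem gives the residual set.

(2) implies (3). This is a linear form of Mycielski's theorem
([linear_mycielski]). Given dense open symmetric sets D n, choose generic
vectors y_n in O_n and generic, rapidly decreasing vectors e_n such that all
nontrivial finite combinations of them with coefficients -1, 0 and 1 lie in
every D n. The Cantor set in O_j is the set of sums y_j + sum_(i > j) a_i e_i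
with binary digits a_i: the difference of two such sums is a combination of this
type, up to a tail that is too small to leave D n.

(3) implies (4). Cantor sets in U and V give a proximal pair in U x V. Two
distinct points of a Cantor set give a vector h with unbounded orbit, and the
perturbations z - h / M show sensitivity at z ([extremely_chaotic_sensitive]).

(4) implies (5). The proximal cell of 0 is the image of the proximal relation by
subtraction. By sensitivity, the vectors whose orbit is far from 0 at some time
after n form a dense open set, so a generic orbit does not tend to 0
([sensitive_not_asymptotic]).

(5) implies (1). The proximal cell is residual. Given x whose orbit does not
tend to 0, a nonempty open set contains y and y + h, both proximal to 0, where h
is a small multiple of x. The orbits of y and y + h cannot both tend to 0
([proximal_cell_semi_irregular]).
*)

(** * Limits superior and inferior as conditions that hold infinitely often *)

Section limit_superior.
Context (R : realType).
Implicit Types (u : nat -> \bar R) (v : nat -> R).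

Lemma limn_esup_gt u c : (c < limn_esup u)%E ->
  forall N, exists2 n, (N <= n)%N & (c < u n)%E.
Proof.
move=> cu N.
have : (c < ereal_sup [set u n | n in [set n | (N <= n)%N]])%E.
  apply: (lt_le_trans cu); apply: ereal_inf_lbound.
  by exists [set n | (N <= n)%N] => //; exact: nbhs_infty_ge.
by move=> /ereal_sup_gt[_ [n Nn <-] cun]; exists n.
Qed.

Lemma limn_esup_ge u c : (forall N, exists2 n, (N <= n)%N & (c <= u n)%E) ->
  (c <= limn_esup u)%E.
Proof.
move=> h; apply: le_ereal_inf_tmp => _ [A [N _ NA] <-].
have [n Nn cun] := h N.
by apply: (le_trans cun); apply: ereal_sup_ubound; exists n => //; exact: NA.
Qed.

Lemma limn_einf_eq0P v : (forall n, 0 <= v n) ->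
  limn_einf (fun n => (v n)%:E) = 0%E <->
  forall e, 0 < e -> forall N, exists2 n, (N <= n)%N & v n < e.
Proof.
move=> v0; rewrite /limn_einf; split=> [vlim e e0 N|h].
- have : ((- e)%:E < limn_esup (fun n => - (v n)%:E))%E.
    by move/eqP: vlim; rewrite oppe_eq0 => /eqP ->; rewrite lte_fin oppr_lt0.
  move=> /limn_esup_gt/(_ N)[n Nn]; rewrite -EFinN lte_fin ltrN2 => vne.
  by exists n.
- apply/eqP; rewrite oppe_eq0 eq_le; apply/andP; split.
    apply: (@le_trans _ _ (ereal_sup [set - (v n)%:E | n in [set: nat]]))%E.
      by apply: ereal_inf_lbound; exists setT => //; exact: filterT.
    by apply: ge_ereal_sup => _ [n _ <-]; rewrite -EFinN lee_fin oppr_le0.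
  apply/lee_subgt0Pr => e e0; rewrite sub0e -EFinN.
  apply: limn_esup_ge => N; have [n Nn vne] := h _ e0 N.
  by exists n => //; rewrite lee_fin lerN2 ltW.
Qed.

Lemma limn_esup_gt0P v :
  (0 < limn_esup (fun n => (v n)%:E))%E <->
  exists2 e, 0 < e & forall N, exists2 n, (N <= n)%N & e < v n.
Proof.
split=> [h|[e e0 h]].
- have [e e0 eh] : exists2 e : R, 0 < e &
      (e%:E < limn_esup (fun n => (v n)%:E))%E.
    case: (limn_esup _) h => [r| |] //= r0.
      by exists (r / 2); rewrite ?lte_fin; move: r0; rewrite lte_fin; lra.
    by exists 1 => //; rewrite ltry.
  exists e => // N; have [n Nn] := limn_esup_gt eh N.
  by rewrite lte_fin; exists n.
- apply: (@lt_le_trans _ _ e%:E); first by rewrite lte_fin.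
  apply: limn_esup_ge => N; have [n Nn evn] := h N.
  by exists n => //; rewrite lee_fin ltW.
Qed.

Lemma limn_esup_pinftyP v :
  limn_esup (fun n => (v n)%:E) = +oo%E <->
  forall M N, exists2 n, (N <= n)%N & M < v n.
Proof.
split=> [h M N|h].
- have : (M%:E < limn_esup (fun n => (v n)%:E))%E by rewrite h ltry.
  by move=> /limn_esup_gt/(_ N)[n Nn]; rewrite lte_fin; exists n.
- apply/eqyP => M _; apply: limn_esup_ge => N; have [n Nn Mvn] := h M N.
  by exists n => //; rewrite lee_fin ltW.
Qed.

End limit_superior.

(** * The F-norm of a Fréchet space *)

Lemma exists_pow2_lt (R : realType) (e : R) : 0 < e -> exists n, 2 ^- n < e.
Proof.
move=> e0; have [n _ /(_ n)] := near_infty_natSinv_expn_lt (PosNum e0).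
by move=> /(_ (leqnn n)) /=; rewrite div1r; exists n.
Qed.

Section frechet_norm.
Context (R : realType) (k : scalar_kind).

(** Scaling by natural numbers and their inverses suffices below, and for these
    the modulus is computed in the same way over both fields. *)
Lemma modulus_nat n : modulus (n%:R : scalars R k) = n%:R.
Proof.
case: k => /=; first exact: normr_nat.
transitivity (complex.Re (n%:R : R[i])).
  exact: (congr1 (@complex.Re R) (normr_nat R[i] n)).
have Re_add1 (z : R[i]) : complex.Re (z + 1) = complex.Re z + 1 by case: z.
by elim: n => [//|n ih]; rewrite !mulrSr -ih.
Qed.

Lemma modulusN1 : modulus (-1 : scalars R k) = 1.
Proof.
case: k; first exact: (normrN1 R).
exact: (congr1 (@complex.Re R) (normrN1 R[i])).
Qed.

Context (X : tvsType (scalars R k)) (p : nat -> X -> R).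
Context (X_frechet : frechet_space p).

Definition fnorm (x : X) := frechet_dist p x 0.
Local Notation N := fnorm.

Lemma frechet_distE x y : frechet_dist p x y = N (x - y).
Proof. by rewrite /N /frechet_dist; under [in RHS]eq_fun do rewrite subr0. Qed.

Lemma seminorm_ge0 j x : 0 <= p j x. Proof. by case: X_frechet => /(_ j)[]. Qed.

Lemma seminormD j x y : p j (x + y) <= p j x + p j y.
Proof. by case: X_frechet => /(_ j)[]. Qed.

Lemma seminormZ j a x : p j (a *: x) = modulus a * p j x.
Proof. by case: X_frechet => /(_ j)[]. Qed.

Lemma seminormMn j x n : p j (x *+ n) = n%:R * p j x.
Proof. by rewrite -scaler_nat seminormZ modulus_nat. Qed.

Lemma seminormN j x : p j (- x) = p j x.
Proof. by rewrite -scaleN1r seminormZ modulusN1 mul1r. Qed.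

Lemma seminorm_divn j x n :
  p j ((n.+1%:R : scalars R k)^-1 *: x) = p j x / n.+1%:R.
Proof.
have n0 : (n.+1%:R : scalars R k) != 0 by rewrite pnatr_eq0.
rewrite -[in RHS](scalerKV n0 x) [in RHS]seminormZ modulus_nat.
by rewrite mulrAC mulfV ?mul1r ?pnatr_eq0.
Qed.

Lemma seminorm_mono j m x : (j <= m)%N -> p j x <= p m x.
Proof.
have [_ pS _ _ _] := X_frechet; elim: m => [|m ih].
  by rewrite leqn0 => /eqP ->.
rewrite leq_eqVlt ltnS => /predU1P[-> //|/ih jm].
exact: le_trans jm (pS _ _).
Qed.

Let S (x : X) := series (fun j => 2 ^- j.+1 * Num.min 1 (p j x)).

Let NE x : N x = limn (S x).
Proof. by rewrite /N /frechet_dist; under eq_fun do rewrite subr0. Qed.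

Let term_ge0 j x : 0 <= 2 ^- j.+1 * Num.min 1 (p j x) :> R.
Proof.
by rewrite mulr_ge0 ?invr_ge0 ?exprn_ge0// le_min ler01 seminorm_ge0.
Qed.

Let S_step x n : S x n.+1 = S x n + 2 ^- n.+1 * Num.min 1 (p n x).
Proof. by rewrite /S /series /= big_nat_recr. Qed.

Let S_nd x : {homo S x : n m / (n <= m)%N >-> n <= m}.
Proof. by apply/nondecreasing_seqP => n; rewrite S_step lerDl. Qed.

(** The m terms from index n on add up to at most
    2^-n - 2^-(n + m), which bounds the series and its remainders. *)
Let S_tail x n m : S x (n + m)%N <= S x n + 2 ^- n - 2 ^- (n + m).
Proof.
elim: m => [|m ih]; first by rewrite addn0 addrK.
rewrite addnS S_step; have min1 : Num.min 1 (p (n + m)%N x) <= 1.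
  by rewrite ge_min lexx.
have h : 2 ^- (n + m).+1 * Num.min 1 (p (n + m)%N x) <= 2 ^- (n + m).+1.
  by rewrite ler_piMr// invr_ge0 exprn_ge0.
have e : 2 ^- (n + m) = 2 ^- (n + m).+1 + 2 ^- (n + m).+1 :> R.
  rewrite exprS invfM; lra.
lra.
Qed.

Let pow_gt0 n : 0 < 2 ^- n :> R. Proof. by rewrite invr_gt0 exprn_gt0. Qed.

Let S_cvg x : cvgn (S x).
Proof.
apply: nondecreasing_is_cvgn; first exact: S_nd.
exists (S x 0 + 1) => _ [n _ <-].
have := S_tail x 0 n; rewrite add0n expr0 invr1.
have := pow_gt0 n; lra.
Qed.

Let S_le x n : S x n <= N x.
Proof.
by rewrite NE; apply: nondecreasing_cvgn_le; [exact: S_nd|exact: S_cvg].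
Qed.

Let N_le x n : N x <= S x n + 2 ^- n.
Proof.
rewrite NE; apply: limr_le; first exact: S_cvg.
exists n => // m /= nm; have := S_tail x n (m - n).
by rewrite subnKC//; have := pow_gt0 m; lra.
Qed.

Lemma fnorm_ge0 x : 0 <= N x.
Proof. by apply: le_trans (S_le x 0); rewrite /S /series /= big_geq. Qed.

Lemma fnorm_ge_seminorm j x : 2 ^- j.+1 * Num.min 1 (p j x) <= N x.
Proof.
apply: le_trans (S_le x j.+1); rewrite S_step lerDr.
by apply: le_trans (S_nd x (leq0n j)); rewrite /S /series /= big_geq.
Qed.

(** The first n weights have total 1 - 2^-n and multiply seminorms that are
    at most [p n x]; the remainder is at most 2^-n. *)
Lemma fnorm_le_seminorm n x : N x <= p n x + 2 ^- n.
Proof.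
apply: (le_trans (N_le x n)); rewrite lerD2r.
have : forall m, (m <= n)%N -> S x m <= (1 - 2 ^- m) * p n x.
  elim=> [|m ih] mn.
    by rewrite /S /series /= big_geq// expr0 invr1 subrr mul0r.
  rewrite S_step.
  have : 2 ^- m.+1 * Num.min 1 (p m x) <= 2 ^- m.+1 * p n x.
    by rewrite ler_pM2l// ge_min seminorm_mono ?orbT// ltnW.
  have e : 2 ^- m = 2 ^- m.+1 + 2 ^- m.+1 :> R by rewrite exprS invfM; lra.
  by have := ih (ltnW mn); rewrite e; lra.
move=> /(_ n (leqnn n)) h; apply: (le_trans h).
by have := pow_gt0 n; have := seminorm_ge0 n x; nra.
Qed.

Lemma fnorm0 : N 0 = 0.
Proof.
rewrite NE (_ : S 0 = fun=> 0); first exact: lim_cst.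
apply/funext => n; rewrite /S /series /= big1// => j _.
by rewrite -(mulr0n 0) seminormMn mul0r (min_idPr _) ?mulr0.
Qed.

Lemma fnormN x : N (- x) = N x.
Proof.
by rewrite !NE; congr (limn (series _)); apply/funext => j; rewrite seminormN.
Qed.

Lemma fnorm_distC x y : N (x - y) = N (y - x).
Proof. by rewrite -fnormN opprB. Qed.

Lemma fnormD x y : N (x + y) <= N x + N y.
Proof.
rewrite [leLHS]NE; apply: limr_le; first exact: S_cvg.
near=> n; apply: (@le_trans _ _ (S x n + S y n)); last by rewrite lerD.
rewrite /S /series /= -big_split /=; apply: ler_sum => j _.
rewrite -mulrDr ler_pM2l//; have := seminormD j x y; have := seminorm_ge0 j x.
have := seminorm_ge0 j y; rewrite !minElt.
by case: ltP => ?; case: ltP => ?; case: ltP => ? ???; lra.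
Unshelve. all: by end_near.
Qed.

Lemma fnormB x y : N (x - y) <= N x + N y.
Proof. by rewrite -(fnormN y) fnormD. Qed.

Lemma fnormMn x n : N (x *+ n) <= n%:R * N x.
Proof.
elim: n => [|n ih]; first by rewrite mulr0n fnorm0 mul0r.
by rewrite mulrS (le_trans (fnormD _ _))// mulrS mulrDl mul1r lerD2l.
Qed.

Lemma seminorm_lt_fnorm j (e : R) : 0 < e ->
  exists2 r, 0 < r & forall x, N x < r -> p j x < e.
Proof.
move=> e0; exists (2 ^- j.+1 * Num.min 1 e).
  by rewrite mulr_gt0// lt_min ltr01.
move=> x /(le_lt_trans (fnorm_ge_seminorm j x)); rewrite ltr_pM2l//.
by rewrite lt_min !gt_min ltxx => /andP[p1 /orP[/(lt_trans p1)|]].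
Qed.

Lemma fnorm_lt_seminorm (e : R) : 0 < e ->
  exists n r, 0 < r /\ forall x, p n x < r -> N x < e.
Proof.
move=> e0; have e2 : 0 < e / 2 by lra.
have [n ne] := exists_pow2_lt e2; exists n, (e / 2); split=> // x pnx.
by have := fnorm_le_seminorm n x; lra.
Qed.

(** All topological arguments below go through this comparison of balls; the
    completeness and the topology of the space are then those of [fnorm]. *)
Lemma nbhs_fnorm x (U : set X) :
  nbhs x U <-> exists2 e, 0 < e & forall y, N (y - x) < e -> U y.
Proof.
have [_ _ _ top _] := X_frechet; rewrite top; split.
- move=> [n [e [e0 U_]]]; have [r r0 rn] := seminorm_lt_fnorm n e0.
  exists r => // y; rewrite fnorm_distC => /rn pne; apply: U_ => j jn /=.
  exact: le_lt_trans (seminorm_mono _ jn) pne.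
- move=> [e e0 U_]; have [n [r [r0 rN]]] := fnorm_lt_seminorm e0.
  exists n, r; split=> // y /(_ n (leqnn n)) /rN; rewrite fnorm_distC.
  exact: U_.
Qed.

Lemma open_fnorm (U : set X) :
  open U <-> forall x, U x -> exists2 e, 0 < e & forall y, N (y - x) < e -> U y.
Proof. by rewrite openE; split=> h x /h /nbhs_fnorm. Qed.

Lemma open_fnorm_ball x e : open [set y | N (y - x) < e].
Proof.
apply/open_fnorm => y /= yx; exists (e - N (y - x)); first by rewrite subr_gt0.
move=> z; have := fnormD (z - y) (y - x); rewrite subrKA; lra.
Qed.

End frechet_norm.

(** * Completeness and Baire's theorem *)

(** The invariant [I] lets the next state be constructed from the current one
    only when the latter is admissible. *)
Lemma dependent_choice_inv (A : Type) (I : nat -> A -> Prop)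
    (P : nat -> A -> A -> Prop) :
  (forall n a, I n a -> exists2 b, I n.+1 b & P n a b) ->
  forall a0, I 0%N a0 ->
  exists2 f : nat -> A, f 0%N = a0 & forall n, I n (f n) /\ P n (f n) (f n.+1).
Proof.
move=> step a0 Ia0.
have /choice[g gP] (na : nat * A) : exists b, I na.1 na.2 ->
    I na.1.+1 b /\ P na.1 na.2 b.
  have [/step[b Ib Pb]|nI] := pselect (I na.1 na.2); first by exists b.
  by exists na.2 => /nI.
pose f := fix f n := if n is m.+1 then g (m, f m) else a0.
have fI n : I n (f n).
  by elim: n => [//|n ih]; have [] := gP (n, f n) ih.
by exists f => // n; split=> //; have [] := gP (n, f n) (fI n).
Qed.

Lemma halving_lt (R : realType) (t : nat -> R) :
  0 <= t 0%N -> (forall n, t n.+1 <= t n / 2) ->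
  forall e, 0 < e -> exists n, t n < e.
Proof.
move=> t0 th e e0; have tn n : t n <= t 0%N * 2 ^- n.
  elim: n => [|n ih]; first by rewrite expr0 invr1 mulr1.
  have e2 : 2 ^- n.+1 = 2 ^- n / 2 :> R by rewrite exprSr invfM.
  by have := th n; rewrite e2; lra.
have d0 : 0 < t 0%N + 1 by lra.
have [n nq] := exists_pow2_lt (divr_gt0 e0 d0).
exists n; apply: (le_lt_trans (tn n)).
by have := divfK (lt0r_neq0 d0) e; nra.
Qed.

Section completeness.
Context (R : realType) (k : scalar_kind) (X : tvsType (scalars R k)).
Context (p : nat -> X -> R).
Context (X_frechet : frechet_space p).
Local Notation N := (fnorm p).

(** A telescoping bound yields both convergence and the rate [t]; it serves for
    the nested balls of Baire's theorem and for the series of small vectors. *)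
Lemma fnorm_cauchy (u : nat -> X) (t : nat -> R) :
  (forall n, 0 <= t n) -> (forall e, 0 < e -> exists n, t n < e) ->
  (forall n, N (u n.+1 - u n) <= t n - t n.+1) ->
  exists l, forall n, N (l - u n) <= t n.
Proof.
move=> t0 tlim ut; have [_ _ _ _ complete] := X_frechet.
have dist n m : N (u (n + m)%N - u n) <= t n - t (n + m)%N.
  elim: m => [|m ih]; first by rewrite addn0 !subrr fnorm0.
  rewrite addnS; have := fnormD X_frechet (u (n + m).+1 - u (n + m)%N)
    (u (n + m)%N - u n).
  by rewrite subrKA; have := ut (n + m)%N; lra.
have dist_le n m : (n <= m)%N -> N (u m - u n) <= t n.
  by move=> nm; have := dist n (m - n)%N; rewrite subnKC//; have := t0 m; lra.
have [|l ul] := complete u.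
  move=> e e0; have e2 : 0 < e / 2 by lra.
  have [n0 tn0] := tlim _ e2; exists n0 => m n n0m n0n.
  rewrite frechet_distE; have := fnormB X_frechet (u m - u n0) (u n - u n0).
  rewrite opprB subrKA.
  have := dist_le _ _ n0m; have := dist_le _ _ n0n; lra.
exists l => n; rewrite leNgt; apply/negP => tn.
have : nbhs l [set y | N (y - l) < N (l - u n) - t n].
  apply/(nbhs_fnorm X_frechet).
  by exists (N (l - u n) - t n); rewrite ?subr_gt0.
move=> /ul[m _ /(_ (maxn m n) (leq_maxl _ _))] /=.
have := dist_le _ _ (leq_maxr m n).
have := fnormB X_frechet (u (maxn m n) - u n) (u (maxn m n) - l).
by rewrite opprB addrC subrKA; lra.
Qed.

(** The state of the construction is a closed ball [xt] with centre [xt.1] and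
    radius [xt.2]; halving the radii makes [fnorm_cauchy] applicable with t the
    sequence of radii, so that the limit belongs to all the balls. *)
Lemma baire (D : nat -> set X) :
  (forall n, open (D n)) -> (forall n, dense (D n)) -> dense (\bigcap_n D n).
Proof.
move=> Dopen Ddense O [x0 Ox0] Oopen.
have closed_ball x (U : set X) : open U -> U x ->
    exists2 t : R, 0 < t & forall y, N (y - x) <= t -> U y.
  move=> /(open_fnorm X_frechet) + Ux => /(_ _ Ux)[e e0 eU].
  by exists (e / 2) => [|y yx]; [lra|apply: eU; lra].
have [t0 t0_gt0 t0O] := closed_ball _ _ Oopen Ox0.
have [|f f0 fP] := @dependent_choice_inv (X * R) (fun _ xt => 0 < xt.2)
   (fun n xt xt' => [/\ xt'.2 <= xt.2 / 2, N (xt'.1 - xt.1) <= xt.2 / 2 &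
      forall y, N (y - xt'.1) <= xt'.2 -> D n y]) _ (x0, t0) t0_gt0.
  move=> n [x t] /= t_gt0.
  have [|x' [/= xx' Dx']] := Ddense n _ _ (open_fnorm_ball X_frechet x (t / 2)).
    by exists x; rewrite /= subrr fnorm0//; lra.
  have [t' t'_gt0 t'D] := closed_ball _ _ (Dopen n) Dx'.
  exists (x', Num.min (t / 2) t') => /=.
    by rewrite lt_min t'_gt0 andbT; lra.
  split; [by rewrite ge_min lexx|exact: ltW|] => y.
  by rewrite le_min => /andP[_]; exact: t'D.
have [l lf] : exists l, forall n, N (l - (f n).1) <= (f n).2.
  apply: fnorm_cauchy => [n|e e0|n]; first by have [/ltW] := fP n.
    by apply: halving_lt e0 => [|n]; [rewrite f0 ltW|have [_ []] := fP n].
  by have [_ [+ + _]] := fP n; lra.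
exists l; split; first by apply: t0O; have := lf 0%N; rewrite f0.
by move=> n _; have [_ [_ _]] := fP n; apply; exact: lf.
Qed.

(** Each translate of D n is again dense and open, and there are countably many
    pairs of an index n and an entry of L. *)
Lemma generic_translates (D : nat -> set X) (L : seq X) (O : set X) :
  (forall n, open (D n)) -> (forall n, dense (D n)) -> open O -> O !=set0 ->
  exists2 y, O y & forall v, v \in L -> forall n, D n (v + y).
Proof.
move=> Dopen Ddense Oopen Oy.
have translate_open v (U : set X) : open U -> open [set y | U (v + y)].
  move=> /(open_fnorm X_frechet) Uopen; apply/(open_fnorm X_frechet) => y.
  move=> /= /Uopen[e e0 eU]; exists e => // z zy; apply: eU.
  by rewrite [v + z]addrC addrKA.
pose D' i : set X := if unpickle i is Some (n, j)
  then [set y | D n (nth 0 L j + y)] else setT.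
have D'open i : open (D' i).
  rewrite /D'; case: (unpickle i) => [[n j]|]; last exact: openT.
  exact: translate_open.
have D'dense i : dense (D' i).
  rewrite /D'; case: (unpickle i) => [[n j]|]; last first.
    by move=> U [x Ux] _; exists x.
  move=> U [x Ux] Uopen; set v := nth 0 L j.
  have [|z [/= Uz Dz]] := Ddense n _ _ (translate_open (- v) U Uopen).
    by exists (v + x); rewrite /= addKr.
  by exists (- v + z); split=> //=; rewrite addNKr.
have [y [Oy' Dy]] := baire D'open D'dense Oy Oopen.
exists y => // v /(nthP 0)[j _ <-] n.
by have := Dy (pickle (n, j)) I; rewrite /D' pickleK.
Qed.

End completeness.

(** * Cantor sets as injective images of the binary sequences *)

Section cantor_codings.
Implicit Types (a b : nat -> bool).

Definition agree (n : nat) a b := forall i, (i < n)%N -> a i = b i.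

(** F is a homeomorphism onto its image, when the binary sequences carry the
    product topology: the sets [agree n a] are a neighbourhood basis of a. *)
Definition cantor_coding (T : topologicalType) (F : (nat -> bool) -> T) :=
  forall a,
    (forall U, nbhs (F a) U -> exists n, forall b, agree n a b -> U (F b)) /\
    (forall n, \forall x \near F a, forall b, F b = x -> agree n a b).

Lemma cantor_coding_inj (T : topologicalType) (F : (nat -> bool) -> T) :
  cantor_coding F -> injective F.
Proof.
move=> Fc a b Fab; apply/funext => i.
have [_ /(_ i.+1)/nbhs_singleton/(_ b (esym Fab))] := Fc a.
exact.
Qed.

(** Decoding along F and coding along G, and conversely. *)
Lemma cantor_coding_homeomorphic (S T : topologicalType)
    (F : (nat -> bool) -> S) (G : (nat -> bool) -> T) :
  cantor_coding F -> cantor_coding G -> homeomorphic_sets (range F) (range G).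
Proof.
pose inv (U : topologicalType) (H : (nat -> bool) -> U) x :=
  xget (fun=> false) [set a | H a = x].
have invK (U : topologicalType) (H : (nat -> bool) -> U) a :
    cantor_coding H -> inv U H (H a) = a.
  move=> /cantor_coding_inj; apply.
  by have := @xgetPex _ (fun=> false) [set b | H b = H a]; apply; exists a.
have continuous_recoding (U V : topologicalType) H K :
    cantor_coding H -> cantor_coding K ->
    {within range H, continuous (K \o inv U H : U -> V)}.
  move=> Hc Kc; apply/subspace_continuousP => _ [a _ <-] W.
  rewrite /from_subspace /= invK// => /(proj1 (Kc a))[n nW].
  have := proj2 (Hc a) n; apply: filterS => x xa [b _ bx].
  by rewrite /= -bx invK//; apply: nW; exact: xa.
move=> Fc Gc; exists (G \o inv S F), (F \o inv T G); split.
- apply/seteqP; split=> [_ [_ [a _ <-] <-]|_ [a _ <-]].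
    by exists (inv S F (F a)).
  by exists (F a); [exists a|rewrite /= invK].
- by move=> _ [a _ <-] /=; rewrite !invK.
- exact: continuous_recoding.
- exact: continuous_recoding.
Qed.

Lemma first_disagreement n a b : ~ agree n a b ->
  exists i, [/\ (i < n)%N, agree i a b & a i != b i].
Proof.
elim: n => [[]//|n ih nab]; have [anb|/ih[i [/ltnW]]] := pselect (agree n a b).
  exists n; split=> //; apply/eqP => abn; apply: nab => i.
  by rewrite ltnS leq_eqVlt => /predU1P[->//|/anb].
by rewrite -ltnS => ? ? ?; exists i.
Qed.

Context (R : realType).

Let digits a (n : nat) : R := (2 * (a n)%:R) / 3 ^+ n.+1.
Let ternary a : R := limn (series (digits a)).

Let pow_gt0 n : 0 < 3 ^- n :> R.
Proof. by rewrite invr_gt0 exprn_gt0. Qed.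

Let pow_step n : 3 ^- n = 3 * 3 ^- n.+1 :> R.
Proof. by rewrite exprS invfM mulrA mulfV ?mul1r. Qed.

Let digits_itv a n : 0 <= digits a n <= 2 * 3 ^- n.+1.
Proof.
rewrite /digits; have := pow_gt0 n.+1.
by case: (a n); rewrite /= ?mulr1 ?mulr0 ?mul0r; lra.
Qed.

Let digits_nd a : {homo series (digits a) : n m / (n <= m)%N >-> n <= m}.
Proof.
apply/nondecreasing_seqP => n; rewrite /series /= big_nat_recr//= lerDl.
by have /andP[] := digits_itv a n.
Qed.

Let digits_tail a n m :
  series (digits a) (n + m)%N <= series (digits a) n + 3 ^- n - 3 ^- (n + m).
Proof.
elim: m => [|m ih]; first by rewrite addn0 addrK.
rewrite addnS /series /= big_nat_recr//=.
have /andP[_] := digits_itv a (n + m)%N.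
move: ih; rewrite /series /= (pow_step (n + m)); lra.
Qed.

Let digits_cvg a : cvgn (series (digits a)).
Proof.
apply: nondecreasing_is_cvgn; first exact: digits_nd.
exists (series (digits a) 0 + 1) => _ [n _ <-].
have := digits_tail a 0 n; rewrite add0n expr0 invr1.
have := pow_gt0 n; lra.
Qed.

Let ternary_itv a n :
  series (digits a) n <= ternary a <= series (digits a) n + 3 ^- n.
Proof.
apply/andP; split.
  by apply: nondecreasing_cvgn_le; [exact: digits_nd|exact: digits_cvg].
apply: limr_le; first exact: digits_cvg.
exists n => // m /= nm; have := digits_tail a n (m - n)%N.
by rewrite subnKC//; have := pow_gt0 m; lra.
Qed.

Let agree_series n a b : agree n a b ->
  series (digits a) n = series (digits b) n.
Proof.
move=> ab; rewrite /series /= !big_mkord.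
by apply: eq_bigr => i _; rewrite /digits ab.
Qed.

(** A digit 2 at the first disagreement contributes 2 * 3^-(i + 1), of which the
    later digits of b recover at most one half. *)
Let ternary_gap i a b : agree i a b -> a i -> ~~ b i ->
  3 ^- i.+1 <= ternary a - ternary b.
Proof.
move=> ab ai bi; have /andP[+ _] := ternary_itv a i.+1.
have /andP[_ +] := ternary_itv b i.+1.
rewrite /series /= !big_nat_recr//= /digits ai (negbTE bi).
have := agree_series ab; rewrite /series /= => -> /=.
rewrite mulr1 mulr0 mul0r; lra.
Qed.

Lemma cantor_ternary_coding :
  cantor_coding
    (fun a => limn (series (fun n => (2 * (a n)%:R) / 3 ^+ n.+1 : R))).
Proof.
move=> a; rewrite -/(ternary a); split=> [U /nbhs_ballP[e /= e0 eU]|n].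
- have [n ne] := exists_pow2_lt e0; exists n => b ab; apply: eU.
  have le32 : 3 ^- n <= 2 ^- n :> R.
    by rewrite lef_pV2 ?posrE ?exprn_gt0// lerXn2r// ?nnegrE// ler_nat.
  have := ternary_itv a n; have := ternary_itv b n.
  rewrite (agree_series ab) => /andP[? ?] /andP[? ?].
  rewrite /ball /= -/(ternary b) ltr_norml; apply/andP; split; lra.
- apply/nbhs_ballP; exists (3 ^- n); first exact: pow_gt0.
  move=> x + b bx; rewrite -bx /ball /= -/(ternary b) => abn.
  apply: contrapT => /first_disagreement[i [ltin ab nab]].
  have le3 : 3 ^- n <= 3 ^- i.+1 :> R.
    by rewrite lef_pV2 ?posrE ?exprn_gt0// ler_weXn2l// ler1n.
  suff : 3 ^- i.+1 <= `|ternary a - ternary b| by move: abn le3; lra.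
  case: (boolP (a i)) nab => [ai|nai]; rewrite ler_normr.
    move=> /esym/eqP/negPf; case bi : (b i) => // _.
    by rewrite ternary_gap// bi.
  case bi : (b i) => // _; rewrite opprB (@ternary_gap i b a) ?orbT// => j /ab.
  by [].
Qed.

End cantor_codings.

(** * A linear form of Mycielski's theorem *)

Section generic_scheme.
Context (R : realType) (k : scalar_kind) (X : tvsType (scalars R k)).
Context (p : nat -> X -> R).
Context (X_frechet : frechet_space p).
Local Notation N := (fnorm p).

Context (D : nat -> set X).
Context (D_open : forall n, open (D n)).
Context (D_dense : forall n, dense (D n)).
Context (D_opp : forall n x, D n x -> D n (- x)).
Context (D_dec : forall n, D n.+1 `<=` D n).
Context (D_0 : ~ D 0%N 0).

Let D_le n m : (n <= m)%N -> D m `<=` D n.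
Proof.
elim: m => [|m ih]; first by rewrite leqn0 => /eqP ->.
by rewrite leq_eqVlt ltnS => /predU1P[->//|/ih] h x /D_dec/h.
Qed.

(** E lists the nontrivial combinations constructed so far, and 0 stands for the
    trivial one: adding [x] creates the combinations with coefficient 1 or -1 at
    [x]. *)
Definition extension (E : seq X) (x : X) : seq X :=
  E ++ [seq v + x | v <- 0 :: E] ++ [seq v - x | v <- 0 :: E].

Lemma sub_extension E x : {subset E <= extension E x}.
Proof. by move=> v vE; rewrite mem_cat vE. Qed.

(** The coefficient is a difference of two bits because the combinations arise
    as differences of points with binary digits. *)
Lemma extension_step E x v (a b : bool) : v \in 0 :: E ->
  v + (x *+ a - x *+ b) \in 0 :: extension E x /\
  (v \in E \/ a <> b -> v + (x *+ a - x *+ b) \in extension E x).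
Proof.
have [->|/eqP anb vE] := eqVneq a b.
  rewrite subrr addr0 !in_cons => /orP[->|vE].
    by split=> // -[/sub_extension|].
  by rewrite sub_extension ?orbT.
suff h : v + (x *+ a - x *+ b) \in extension E x by rewrite in_cons h orbT.
rewrite !mem_cat; case: a b anb => [] [] // _; rewrite ?mulr0n ?mulr1n.
  by rewrite subr0 (map_f (fun v => v + x)) ?orbT.
by rewrite sub0r (map_f (fun v => v - x)) ?orbT.
Qed.

(** By symmetry of D n, v - x lies in D n as soon as x - v does, so that all
    conditions on x concern translates of x. *)
Lemma generic_extension E (O : set X) :
  (forall v, v \in E -> forall n, D n v) -> open O -> O !=set0 ->
  exists2 x, O x & forall v, v \in extension E x -> forall n, D n v.
Proof.
move=> ED Oopen Oneq0.
have [x Ox xD] := generic_translates X_frechet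
  (0 :: E ++ [seq - v | v <- 0 :: E]) D_open D_dense Oopen Oneq0.
exists x => // v; rewrite !mem_cat.
move=> /or3P[/ED//|/mapP[w wE ->]|/mapP[w wE ->]] n.
  by apply: xD; rewrite -cat_cons mem_cat wE.
rewrite -opprB; apply: D_opp; rewrite addrC; apply: xD.
by rewrite -cat_cons mem_cat map_f ?orbT.
Qed.

Lemma uniform_radius (E : seq X) (U : set X) :
  open U -> (forall v, v \in E -> U v) ->
  exists2 r, 0 < r & forall v h, v \in E -> N h < r -> U (v + h).
Proof.
move=> /(open_fnorm X_frechet) Uopen; elim: E => [|w E ih] EU.
  by exists 1.
have [|r r0 rE] := ih; first by move=> v vE; apply: EU; rewrite in_cons vE orbT.
have [|e e0 eU] := Uopen w; first by apply: EU; rewrite mem_head.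
exists (Num.min r e); first by rewrite lt_min r0.
move=> v h; rewrite in_cons lt_min => /predU1P[->|vE] /andP[hr he].
  by apply: eU; rewrite addrC addKr.
exact: rE.
Qed.

(** [E n] lists the nontrivial combinations of [y i] and [e i] with i < n. The
    bounds on [e] and [rho] make every tail of the [e i] with i >= n at most
    [rho n / 4]; hence, by the last two fields, the tails from n + 1 on neither
    take a combination out of [D n] nor take [y n] out of [O n]. *)
Record scheme (O : nat -> set X) (y e : nat -> X) (rho : nat -> R)
    (E : nat -> seq X) : Prop := {
  rho_gt0 : forall n, 0 < rho n;
  rho_half : forall n, rho n.+1 <= rho n / 2;
  e_small : forall n, N (e n) <= rho n / 8;
  E_step : forall n, E n.+1 = extension (extension (E n) (y n)) (e n);
  E_ball : forall n v h, v \in E n.+1 -> N h < rho n.+1 -> D n (v + h);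
  y_ball : forall n h, N h < rho n.+1 -> O n (y n + h)
}.

Lemma exists_scheme (O : nat -> set X) :
  (forall j, open (O j) /\ O j !=set0) ->
  exists y e rho E, scheme O y e rho E.
Proof.
move=> O_open.
pose I (n : nat) (s : seq X * R * X * X) := let: (E, rho, _, _) := s in
  0 < rho /\ forall v, v \in E -> forall n, D n v.
pose P n (s s' : seq X * R * X * X) :=
  let: (E, rho, _, _) := s in let: (E', rho', y, e) := s' in
  [/\ rho' <= rho / 2, N e <= rho / 8, E' = extension (extension E y) e,
      forall v h, v \in E' -> N h < rho' -> D n (v + h) &
      forall h, N h < rho' -> O n (y + h)].
have [| |f _ fP] := @dependent_choice_inv _ I P _ ([::], 1, 0, 0).
- move=> n [[[E rho] y0] e0] [rho0 ED]; have [Oopen Oneq0] := O_open n.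
  have [y Oy yD] := generic_extension ED Oopen Oneq0.
  have [|e /= e_lt eD] :=
      generic_extension yD (open_fnorm_ball X_frechet 0 (rho / 8)).
    by exists 0; rewrite /= subr0 fnorm0//; lra.
  have [r r0 rE] := uniform_radius (D_open n) (fun v vE => eD v vE n).
  have [|s s0 sO] := @uniform_radius [:: y] (O n) Oopen.
    by move=> v; rewrite inE => /eqP ->.
  exists (extension (extension E y) e, Num.min (rho / 2) (Num.min r s), y, e).
    split; last exact: eD.
    by rewrite !lt_min r0 s0 !andbT; lra.
  split=> //.
  + by rewrite ge_min lexx.
  + by move: e_lt; rewrite subr0 => /ltW.
  + by move=> v h vE; rewrite !lt_min => /and3P[_ hr _]; exact: rE.
  + move=> h; rewrite !lt_min => /and3P[_ _ hs].
    by apply: sO; rewrite ?mem_head.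
- by split.
exists (fun n => (f n.+1).1.2), (fun n => (f n.+1).2), (fun n => (f n).1.1.2),
  (fun n => (f n).1.1.1).
by split=> n; have [] := fP n; rewrite /I /P;
  case: (f n) => [[[? ?] ?] ?]; case: (f n.+1) => [[[? ?] ?] ?] [] //= ? ? [].
Qed.

Section points.
Context (O : nat -> set X) (y e : nat -> X) (rho : nat -> R) (E : nat -> seq X).
Context (S : scheme O y e rho E).
Implicit Types (a b : nat -> bool) (s t : nat -> bool * bool).

Let rho_le n m : (n <= m)%N -> rho m <= rho n.
Proof.
elim: m => [|m ih]; first by rewrite leqn0 => /eqP ->.
rewrite leq_eqVlt ltnS => /predU1P[->//|/ih].
by have := rho_half S m; have := rho_gt0 S m; lra.
Qed.

(** The two bits of [s i] are the digits of a point at [y i] and at [e i]. *)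
Definition partial_point s n := \sum_(i < n) (y i *+ (s i).1 + e i *+ (s i).2).

Lemma partial_pointS s n : partial_point s n.+1 =
  partial_point s n + (y n *+ (s n).1 + e n *+ (s n).2).
Proof. exact: big_ord_recr. Qed.

(** Once two digit sequences have disagreed, the difference of their partial
    sums has entered the list of nontrivial combinations, and never leaves it. *)
Lemma partial_point_diff s t n :
  partial_point s n - partial_point t n \in 0 :: E n /\
  forall i, (i < n)%N -> s i <> t i ->
    partial_point s n - partial_point t n \in E n.
Proof.
elim: n => [|n [ih0 ih]].
  by rewrite /partial_point !big_ord0 subrr mem_head; split.
rewrite !partial_pointS (E_step S).
set q := partial_point s n - partial_point t n in ih0 ih *.
have -> : partial_point s n + (y n *+ (s n).1 + e n *+ (s n).2) -
    (partial_point t n + (y n *+ (t n).1 + e n *+ (t n).2)) =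
    q + (y n *+ (s n).1 - y n *+ (t n).1) + (e n *+ (s n).2 - e n *+ (t n).2).
  by rewrite !opprD addrACA [X in _ + X]addrACA addrA.
have [q1 q1E] := extension_step (y n) (s n).1 (t n).1 ih0.
have [q2 q2E] := extension_step (e n) (s n).2 (t n).2 q1.
split=> // i; rewrite ltnS leq_eqVlt => /predU1P[->|/ih{}ih] st; apply: q2E.
  have [st1|?] := eqVneq (s n).1 (t n).1.
  2: by left; apply: q1E; right; exact/eqP.
  right=> st2; apply: st.
  by rewrite [LHS]surjective_pairing [RHS]surjective_pairing st1 st2.
by left; apply: q1E; left; exact: ih.
Qed.

(** The digits of the point y_j + sum_(i > j) a_(i - j - 1) e_i. The sum starts
    after j because [y_ball] controls the tails from index j + 1 on. *)
Definition code (j : nat) a : nat -> bool * bool :=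
  fun i => (i == j, (j < i)%N && a (i - j.+1)%N).

Lemma code_shift j a i : code j a (j.+1 + i)%N = (false, a i).
Proof.
by rewrite /code addKn ltn_addr// andTb gtn_eqF// ltn_addr.
Qed.

Lemma code_inj j a j' a' : (forall i, code j a i = code j' a' i) ->
  j = j' /\ a = a'.
Proof.
move=> cc; have [jj _] := cc j; move: jj; rewrite eqxx => /esym/eqP jj'.
split=> //; apply/funext => i; have := cc (j.+1 + i)%N.
by rewrite -jj' !code_shift => -[].
Qed.

Lemma agree_code n j a b : agree n a b ->
  forall i, (i < j.+1 + n)%N -> code j a i = code j b i.
Proof.
move=> ab i ijn; rewrite /code; congr pair; case: ltnP => //= ji.
by apply: ab; rewrite ltn_subLR.
Qed.

Lemma exists_points : exists F : nat -> (nat -> bool) -> X,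
  (forall j a, O j (F j a)) /\
  forall j a n, (j < n)%N ->
    N (F j a - partial_point (code j a) n) <= rho n / 4.
Proof.
have /choice[sum sumP] (c : nat -> bool) : exists l, forall n,
    N (l - \sum_(i < n) e i *+ c i) <= rho n / 4.
  apply: (fnorm_cauchy X_frechet) => [n|r r0|n].
  - by have := rho_gt0 S n; lra.
  - apply: halving_lt r0 => [|n]; first by have := rho_gt0 S 0; lra.
    by have := rho_half S n; lra.
  - rewrite big_ord_recr /= addrAC subrr add0r.
    have : N (e n *+ c n) <= N (e n).
      by case: (c n); rewrite // mulr0n fnorm0// fnorm_ge0.
    by have := e_small S n; have := rho_half S n; lra.
exists (fun j a => y j + sum (fun i => (code j a i).2)); split=> [j a|j a n jn].
- apply: (y_ball S); have := sumP (fun i => (code j a i).2) j.+1.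
  rewrite big1 ?subr0 => [|i _]; first by have := rho_gt0 S j.+1; lra.
  by rewrite /code /= ltnNge -ltnS ltn_ord.
- have -> : partial_point (code j a) n =
      y j + \sum_(i < n) e i *+ (code j a i).2.
    rewrite /partial_point big_split /=; congr (_ + _).
    rewrite (bigD1 (Ordinal jn)) //= eqxx big1 ?addr0// => i.
    by rewrite -val_eqE /= => /negbTE ->.
  by rewrite opprD addrACA subrr add0r.
Qed.

Section cantor_points.
Context (F : nat -> (nat -> bool) -> X).
Context (F_lim : forall j a n, (j < n)%N ->
  N (F j a - partial_point (code j a) n) <= rho n / 4).

Lemma difference_split j a j' a' n : (j < n)%N -> (j' < n)%N ->
  N (F j a - F j' a' -
     (partial_point (code j a) n - partial_point (code j' a') n)) <= rho n / 2.
Proof.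
move=> jn j'n; have := F_lim a jn; have := F_lim a' j'n.
have := fnormB X_frechet (F j a - partial_point (code j a) n)
  (F j' a' - partial_point (code j' a') n).
by rewrite !opprD !opprK addrACA; lra.
Qed.

(** The combination is taken at a stage beyond n and beyond the disagreement;
    this is where the sets D n have to decrease. *)
Lemma generic_difference j a j' a' i n : code j a i <> code j' a' i ->
  D n (F j a - F j' a').
Proof.
move=> cc; pose m := (i + j + j' + n)%N.
apply: (@D_le n m); first by rewrite leq_addl.
have [_ /(_ i)] := partial_point_diff (code j a) (code j' a') m.+1.
have im : (i < m.+1)%N by rewrite ltnS /m -!addnA leq_addr.
move=> /(_ im cc)/(E_ball S); set q := _ - _.
rewrite -[F j a - F j' a'](subrKC q); apply.
have := rho_gt0 S m.+1; have := @difference_split j a j' a' m.+1.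
rewrite -/q => h; suff : N (F j a - F j' a' - q) <= rho m.+1 / 2 by lra.
by apply: h; rewrite ltnS /m; lia.
Qed.

(** If the two points were closer, the nontrivial combination q would be shorter
    than [rho n.+1]; then 0 = q - q would lie in [D n], hence in [D 0]. *)
Lemma difference_gap j a j' a' i n : (i <= n)%N -> (j <= n)%N -> (j' <= n)%N ->
  code j a i <> code j' a' i -> rho n.+1 / 2 <= N (F j a - F j' a').
Proof.
move=> ni nj nj' cc; rewrite leNgt; apply/negP => lt_rho.
have [_ /(_ i ni cc)] := partial_point_diff (code j a) (code j' a') n.+1.
have := @difference_split j a j' a' n.+1 nj nj'; set q := _ - partial_point _ _.
move=> le_rho /(E_ball S (h := - q)); rewrite subrr fnormN//.
have := fnormB X_frechet (F j a - F j' a') (F j a - F j' a' - q).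
rewrite opprB addrC subrK => le_sum.
by move=> h; apply: D_0; apply: (D_le (leq0n n)); apply: h; lra.
Qed.

(** Continuity comes from the decay of the tails, and continuity of the inverse
    from [difference_gap]. *)
Lemma points_coding j : cantor_coding (F j).
Proof.
move=> a; split=> [U /(nbhs_fnorm X_frechet)[r r0 rU]|n].
- have [|n rho_r] := halving_lt _ (rho_half S) r0; first exact/ltW/(rho_gt0 S).
  exists n => b ab; apply: rU.
  have jn : (j < j.+1 + n)%N by rewrite leq_addr.
  have := @difference_split j b j a _ jn jn.
  have -> : partial_point (code j b) (j.+1 + n) =
      partial_point (code j a) (j.+1 + n).
    by apply: eq_bigr => i _; rewrite (agree_code (b := b) ab).
  have : rho (j.+1 + n)%N <= rho n by rewrite rho_le ?leq_addl.
  rewrite subrr subr0.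
  by have := rho_gt0 S (j.+1 + n); lra.
- apply/(nbhs_fnorm X_frechet); exists (rho (j.+1 + n).+1 / 2).
    by have := rho_gt0 S (j.+1 + n).+1; lra.
  move=> x + b bx; rewrite -bx => lt_rho i ltin; apply: contrapT => abi.
  have : rho (j.+1 + n).+1 / 2 <= N (F j b - F j a).
    apply: (@difference_gap _ _ _ _ (j.+1 + i)%N); rewrite ?code_shift; try lia.
    by case=> /esym.
  lra.
Qed.

End cantor_points.

End points.

Theorem linear_mycielski (O : nat -> set X) :
  (forall j, open (O j) /\ O j !=set0) ->
  exists K : nat -> set X,
    (forall j, cantor_set R (K j) /\ K j `<=` O j) /\
    forall x y, (\bigcup_j K j) x -> (\bigcup_j K j) y -> x <> y ->
      forall n, D n (x - y).
Proof.
move=> /exists_scheme[y [e [rho [E S]]]].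
have [F [FO Flim]] := exists_points S.
exists (fun j => range (F j)).
split=> [j|_ _ [j _ [a _ <-]] [j' _ [a' _ <-]] neq n].
  split; last by move=> _ [a _ <-].
  apply: cantor_coding_homeomorphic; first exact: cantor_ternary_coding.
  exact: (points_coding S Flim).
have [i cc] : exists i, code j a i <> code j' a' i.
  apply: contrapT => /forallNP cc; apply: neq.
  by have [|-> ->] := @code_inj j a j' a' _ => // i; exact: contrapT.
exact: (generic_difference S Flim n cc).
Qed.

End generic_scheme.

(** * Orbits of a continuous linear operator *)

Section orbits.
Context (R : realType) (k : scalar_kind) (X : tvsType (scalars R k)).
Context (p : nat -> X -> R) (T : {linear X -> X}).
Context (X_frechet : frechet_space p).
Context (T_continuous : continuous T).
Local Notation N := (fnorm p).

Lemma iter_linearB n x y : iter n T (x - y) = iter n T x - iter n T y.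
Proof. by elim: n => //= n ->; rewrite linearB. Qed.

Lemma iter_linear0 n : iter n T 0 = 0.
Proof. by elim: n => //= n ->; rewrite linear0. Qed.

Lemma iter_linearZ n a x : iter n T (a *: x) = a *: iter n T x.
Proof. by elim: n => //= n ->; rewrite linearZ. Qed.

Lemma iter_linearMn n m x : iter n T (x *+ m) = iter n T x *+ m.
Proof. by elim: n => //= n ->; rewrite linearMn. Qed.

Lemma iter_continuous n : continuous (iter n T).
Proof.
elim: n => [|n ih] x; first exact: cvg_id.
exact: (continuous_comp (ih x) (@T_continuous _)).
Qed.

Lemma open_iter n (U : set X) : open U -> open [set x | U (iter n T x)].
Proof. have /continuousP h := @iter_continuous n; exact: h. Qed.

Lemma iter_fnorm n r : 0 < r ->
  exists2 d, 0 < d & forall h, N h < d -> N (iter n T h) < r.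
Proof.
move=> r0; have := open_iter n (open_fnorm_ball X_frechet 0 r).
move=> /(open_fnorm X_frechet)/(_ 0)[|d d0 dr].
  by rewrite /= iter_linear0 subr0 fnorm0.
by exists d => // h hd; have := dr h; rewrite /= !subr0; exact.
Qed.

Lemma iter_fnorm_lt n r : 0 < r ->
  exists2 d, 0 < d & forall h i, (i < n)%N -> N h < d -> N (iter i T h) < r.
Proof.
move=> r0; elim: n => [|n [d d0 dr]]; first by exists 1.
have [d' d'0 d'r] := iter_fnorm n r0; exists (Num.min d d').
  by rewrite lt_min d0.
move=> h i; rewrite ltnS leq_eqVlt lt_min => /predU1P[->|ltin] /andP[hd hd'].
  exact: d'r.
exact: dr.
Qed.

Lemma proximal_dist x y n :
  frechet_dist p (iter n T x) (iter n T y) = N (iter n T (x - y)).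
Proof. by rewrite frechet_distE iter_linearB. Qed.

Lemma proximal_dist0 y n :
  frechet_dist p (iter n T 0) (iter n T y) = N (iter n T y).
Proof. by rewrite frechet_distE iter_linear0 sub0r fnormN. Qed.

Definition near_zero (n : nat) : set X :=
  [set x | exists2 i, (n <= i)%N & N (iter i T x) < n.+1%:R^-1].

Definition large (m n : nat) : set X :=
  [set x | exists2 i, (n <= i)%N & n%:R < p m (iter i T x)].

Lemma open_eventually (P : nat -> set X) (n : nat) : (forall i, open (P i)) ->
  open [set x | exists2 i, (n <= i)%N & P i (iter i T x)].
Proof.
move=> Popen.
have -> : [set x | exists2 i, (n <= i)%N & P i (iter i T x)] =
    \bigcup_(i in [set i | (n <= i)%N]) [set x | P i (iter i T x)] by [].
by apply: bigcup_open => i _; exact: open_iter.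
Qed.

Lemma near_zero_open n : open (near_zero n).
Proof.
apply: (@open_eventually (fun=> [set x | N x < n.+1%:R^-1])) => _.
have := open_fnorm_ball X_frechet 0 n.+1%:R^-1.
by congr open; apply/seteqP; split=> x /=; rewrite subr0.
Qed.

Lemma fnorm_gt_open (r : R) : open [set x | r < N x].
Proof.
apply/(open_fnorm X_frechet) => x /= rx; exists (N x - r); rewrite ?subr_gt0//.
move=> y; have := fnormB X_frechet y (y - x).
by rewrite opprB subrKC; lra.
Qed.

Lemma large_open m n : open (large m n).
Proof.
apply: (@open_eventually (fun=> [set x | n%:R < p m x])) => _.
apply/(open_fnorm X_frechet) => x /=; rewrite -subr_gt0.
move=> /(seminorm_lt_fnorm X_frechet m)[r r0 rm]; exists r => // y /rm.
have := seminormD X_frechet m y (x - y); rewrite subrKC.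
by rewrite -(seminormN X_frechet m (x - y)) opprB; lra.
Qed.

Lemma einf_near_zeroP x :
  limn_einf (fun n => (N (iter n T x))%:E) = 0%E <-> forall n, near_zero n x.
Proof.
have N0 n : 0 <= N (iter n T x) by exact: fnorm_ge0.
rewrite limn_einf_eq0P//; split=> [h n|h r r0 n].
  by apply: h; rewrite invr_gt0.
pose m := (n + Num.truncn r^-1)%N; have [i mi iN] := h m.
exists i; first by rewrite (leq_trans _ mi)// leq_addr.
apply: (lt_le_trans iN); rewrite -[leRHS]invrK lef_pV2 ?posrE ?invr_gt0//.
apply: ltW; apply: (lt_le_trans (truncnS_gt _)).
by rewrite ler_nat ltnS leq_addl.
Qed.

Lemma esup_largeP m x :
  limn_esup (fun n => (p m (iter n T x))%:E) = +oo%E <-> forall n, large m n x.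
Proof.
rewrite limn_esup_pinftyP; split=> [h n|h M n]; first exact: h.
pose q := (n + (Num.truncn M).+1)%N; have [i qi iM] := h q.
exists i; first by rewrite (leq_trans _ qi)// leq_addr.
apply: lt_trans iM; apply: (lt_le_trans (truncnS_gt _)).
by rewrite ler_nat leq_addl.
Qed.

Lemma near_zero_dense (S : set X) : dense S ->
  (forall x, S x -> forall n, near_zero n x) -> forall n, dense (near_zero n).
Proof.
move=> Sdense Snear n O O0 Oopen; have [x [Ox Sx]] := Sdense O O0 Oopen.
by exists x; split=> //; exact: Snear.
Qed.

(** Otherwise the iterates T^i with i >= n are bounded in p_m on a ball around
    some z, hence on a ball around 0 by taking differences, hence at most r / 2
    on a smaller ball by scaling. The orbit of x enters that ball, and from n
    steps later on it remains at distance less than r from 0, since m is such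
    that p_m at most r / 2 implies N < r. *)
Lemma large_dense x : (forall n, near_zero n x) ->
  (0 < limn_esup (fun n => (N (iter n T x))%:E))%E ->
  exists m, forall n, dense (large m n).
Proof.
move=> xnear /limn_esup_gt0P[r r0 xr].
have r2 : 0 < r / 2 by lra.
have [m mr] := exists_pow2_lt r2; exists m => n; apply: contrapT => nd.
have [V [[z [Vopen Vz]] Vlarge]] := denseNE nd.
have [d d0 dV] := proj1 (open_fnorm X_frechet V) Vopen z Vz.
have small y i : V y -> (n <= i)%N -> p m (iter i T y) <= n%:R.
  move=> Vy ni; rewrite leNgt; apply/negP => lt_p.
  suff : (V `&` large m n) y by rewrite Vlarge.
  by split=> //; exists i.
have bounded h i : N h < d -> (n <= i)%N -> p m (iter i T h) <= n%:R *+ 2.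
  move=> hd ni; have Vzh : V (z + h) by apply: dV; rewrite addrC addKr.
  have -> : h = (z + h) - z by rewrite addrC addKr.
  rewrite iter_linearB; apply: (le_trans (seminormD X_frechet _ _ _)).
  by rewrite (seminormN X_frechet) mulr2n lerD// small.
pose M := (Num.truncn (n%:R *+ 2 / (r / 2))).+1.
have M0 : 0 < M%:R :> R by rewrite ltr0n.
have Mr : n%:R *+ 2 <= M%:R * (r / 2).
  by rewrite -ler_pdivrMr// ltW// truncnS_gt.
have shrink h i : N h < d / M%:R -> (n <= i)%N -> p m (iter i T h) <= r / 2.
  rewrite ltr_pdivlMr// mulrC => hd ni.
  have := @bounded (h *+ M) i (le_lt_trans (fnormMn X_frechet h M) hd) ni.
  rewrite iter_linearMn (seminormMn X_frechet) => /le_trans/(_ Mr).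
  by rewrite ler_pM2l.
have /limn_einf_eq0P xlim := proj2 (einf_near_zeroP x) xnear.
have [i0 _ xi0] := xlim (fun=> fnorm_ge0 X_frechet _) _ (divr_gt0 d0 M0) 0%N.
have [i i0i ri] := xr (i0 + n)%N.
have := shrink (iter i0 T x) (i - i0)%N xi0.
rewrite -iterD subnK; last by rewrite (leq_trans _ i0i)// leq_addr.
have := fnorm_le_seminorm X_frechet m (iter i T x).
have ni : (n <= i - i0)%N by rewrite leq_subRL ?(leq_trans _ i0i)// leq_addr.
by move=> + /(_ ni); lra.
Qed.

End orbits.
(** * The implications *)

Lemma cantor_set_two_points (R : realType) (X : topologicalType) (K : set X) :
  cantor_set R K -> exists x y, [/\ K x, K y & x <> y].
Proof.
move=> [f [g [<- gf _ _]]].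
have G_inj := cantor_coding_inj (@cantor_ternary_coding R).
set G := (fun a => _) in G_inj.
exists (f (G (fun=> true))), (f (G (fun=> false))).
have GC a : cantor_ternary (G a) by exists a.
split; [by exists (G (fun=> true))|by exists (G (fun=> false))|].
move=> /(congr1 g); rewrite !gf// => /G_inj/(congr1 (fun a => a 0%N)).
by [].
Qed.

Section equivalences.
Context (R : realType) (k : scalar_kind) (X : tvsType (scalars R k)).
Context (p : nat -> X -> R) (T : {linear X -> X}).
Context (X_frechet : frechet_space p).
Context (T_continuous : continuous T).
Local Notation N := (fnorm p).
Local Notation near_zero := (near_zero p T).
Local Notation large := (large p T).

Lemma shrink_fnorm h r : 0 < r ->
  exists n, N ((n.+1%:R : scalars R k)^-1 *: h) < r.
Proof.
move=> /(fnorm_lt_seminorm X_frechet)[m [s [s0 sr]]].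
exists (Num.truncn (p m h / s)); apply: sr; rewrite (seminorm_divn X_frechet).
by rewrite ltr_pdivrMr ?ltr0n// mulrC -ltr_pdivrMr// truncnS_gt.
Qed.

Lemma semi_irregular_residual_irregular (S : set X) : dense S ->
  (forall x, S x -> semi_irregular p T x) ->
  exists (m : nat) (A : set X),
    residual A /\ forall x, A x -> irregular p T m x.
Proof.
move=> Sdense Ssemi.
have Snear x : S x -> forall n, near_zero n x.
  by move=> /Ssemi[/(einf_near_zeroP T X_frechet)].
have [|x [_ Sx]] := Sdense setT _ openT; first by exists 0.
have [m mdense] := large_dense X_frechet (Snear x Sx) (proj2 (Ssemi x Sx)).
pose D n := near_zero n `&` large m n.
have Dopen n : open (D n).
  by apply: openI; [exact: near_zero_open|exact: large_open].
have Ddense n : dense (D n).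
  apply: denseI => //; first exact: near_zero_open.
  exact: near_zero_dense Sdense Snear n.
exists m, (\bigcap_n D n); split.
  exists (\bigcap_n D n); split=> //; first by exists D.
  exact: (baire X_frechet Dopen Ddense).
move=> y Dy; split.
  by apply/(einf_near_zeroP T X_frechet) => n; have [] := Dy n I.
by apply/esup_largeP => n; have [] := Dy n I.
Qed.

Lemma residual_irregular_scrambled m (A : set X) : residual A ->
  (forall x, A x -> irregular p T m x) ->
  forall O : nat -> set X, (forall j, open (O j) /\ O j !=set0) ->
  exists K : nat -> set X,
    (forall j, cantor_set R (K j) /\ K j `<=` O j) /\
    li_yorke_extremely_scrambled p T m (\bigcup_j K j).
Proof.
move=> [G [_ Gdense GA]] Airr O Oopen.
have Gnear x : G x -> forall n, near_zero n x.
  by move=> /GA/Airr[/(einf_near_zeroP T X_frechet)].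
have Glarge x : G x -> forall n, large m n x by move=> /GA/Airr[_ /esup_largeP].
pose D n := near_zero n `&` large m n.
have Dopen n : open (D n).
  by apply: openI; [exact: near_zero_open|exact: large_open].
have Ddense n : dense (D n).
  move=> V V0 Vopen; have [x [Vx Gx]] := Gdense V V0 Vopen.
  by exists x; split=> //; split; [exact: Gnear|exact: Glarge].
have Dopp n x : D n x -> D n (- x).
  have iterN i : iter i T (- x) = - iter i T x.
    by rewrite -sub0r iter_linearB iter_linear0 sub0r.
  move=> [[i ni iN] [j nj jp]]; split; [exists i|exists j] => //.
    by rewrite iterN fnormN.
  by rewrite iterN (seminormN X_frechet).
have Ddec n : D n.+1 `<=` D n.
  move=> x [[i ni iN] [j nj jp]]; split; [exists i|exists j]; try exact: ltnW.
    by apply: (lt_le_trans iN); rewrite lef_pV2 ?posrE ?ltr0n// ler_nat.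
  by apply: le_lt_trans jp; rewrite ler_nat.
have D0 : ~ D 0%N 0.
  move=> [_ [i _]]; rewrite iter_linear0 -(mulr0n 0) (seminormMn X_frechet).
  by rewrite mul0r ltxx.
have [K [KO KD]] := linear_mycielski X_frechet Dopen Ddense Dopp Ddec D0 Oopen.
exists K; split=> // x y Kx Ky xy; split.
  under eq_fun do rewrite (proximal_dist p).
  by apply/(einf_near_zeroP T X_frechet) => n; have [] := KD x y Kx Ky xy n.
under eq_fun do rewrite -iter_linearB.
by apply/esup_largeP => n; have [] := KD x y Kx Ky xy n.
Qed.

Lemma scrambled_proximal_dense m :
  (forall O : nat -> set X, (forall j, open (O j) /\ O j !=set0) ->
    exists K : nat -> set X,
      (forall j, cantor_set R (K j) /\ K j `<=` O j) /\
      li_yorke_extremely_scrambled p T m (\bigcup_j K j)) ->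
  dense (proximal_relation p T : set (X * X)).
Proof.
move=> scrambled W [[a b] Wab] Wopen.
have [[U V] /= [Ua Vb] UVW] : nbhs (a, b) W by exact: open_nbhs_nbhs.
have [|K [KO Ksc]] := scrambled (fun j => if j == 0%N then U^° else V^°).
  by case=> [|j] /=; (split; first exact: open_interior); [exists a|exists b].
have [[C0 K0U] [C1 K1V]] := (KO 0%N, KO 1%N).
have [x [_ [K0x _ _]]] := cantor_set_two_points C0.
have [y [_ [K1y _ _]]] := cantor_set_two_points C1.
exists (x, y); split.
  by apply: UVW; split; apply: interior_subset; [exact: K0U|exact: K1V].
rewrite /proximal_relation /proximal /=; have [<-|/eqP xy] := eqVneq x y.
  under eq_fun do rewrite frechet_distE subrr fnorm0//.
  by apply/limn_einf_eq0P => // e e0 n; exists n.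
by have [] := Ksc x y _ _ xy; [exists 0%N|exists 1%N|].
Qed.

(** At a time when p_m(T^n (x - y)) exceeds M + 1, the vector (x - y) / (M + 1)
    has p_m at least 1, hence norm at least 2^-(m + 1); the sensitivity constant
    is half of this. *)
Lemma extremely_chaotic_sensitive m x y :
  li_yorke_extremely_chaotic p T m x y -> sensitive p T.
Proof.
move=> [_ /limn_esup_pinftyP xy]; have pow_gt0 i : 0 < 2 ^- i :> R.
  by rewrite invr_gt0 exprn_gt0.
exists (2 ^- m.+2) => // z e e0.
have [M Me] := shrink_fnorm (x - y) e0.
have [n n0 Mn] := xy M.+1%:R 1%N.
exists (z - (M.+1%:R : scalars R k)^-1 *: (x - y)), n; split=> //.
  by rewrite frechet_distE opprB subrKC.
rewrite (proximal_dist p) opprB subrKC iter_linearZ.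
apply: lt_le_trans (fnorm_ge_seminorm X_frechet m _).
rewrite (seminorm_divn X_frechet) iter_linearB (min_idPl _).
  by rewrite mulr1 ltf_pV2 ?posrE ?exprn_gt0// ltr_eXn2l// ltr1n.
by rewrite ler_pdivlMr ?ltr0n// mul1r ltW.
Qed.

Lemma proximal_relation_cell_dense :
  dense (proximal_relation p T : set (X * X)) ->
  dense (proximal_cell p T 0 : set X).
Proof.
move=> prox V [v Vv] Vopen.
have [||[x y] [/= Vxy proxy]] := prox [set xy | V (xy.1 - xy.2)].
- by exists (v, 0); rewrite /= subr0.
- have /continuousP h := @sub_continuous X; exact: h.
exists (x - y); split=> //; rewrite /proximal_cell /proximal /=.
under eq_fun do rewrite (proximal_dist0 T X_frechet).
by under eq_fun do rewrite -(proximal_dist p).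
Qed.

(** If z and a nearby y are d apart at time i, one of them is at distance more
    than d / 2 from 0. The closeness of y and z can be chosen so that this does
    not happen before time n. *)
Lemma sensitive_not_asymptotic : sensitive p T ->
  exists x : X, (0 < limn_esup (fun n => (N (iter n T x))%:E))%E.
Proof.
move=> [d d0 sens].
have d2 : 0 < d / 2 by lra.
pose far (n : nat) := [set x | exists2 i, (n <= i)%N & d / 2 < N (iter i T x)].
have far_open n : open (far n).
  apply: (open_eventually T_continuous (P := fun=> [set x | d / 2 < N x])) => _.
  exact: fnorm_gt_open.
have far_dense n : dense (far n).
  move=> V [z Vz] Vopen.
  have [r r0 rV] := proj1 (open_fnorm X_frechet V) Vopen z Vz.
  have [s s0 sd] := iter_fnorm_lt X_frechet T_continuous n d0.
  have rs0 : 0 < Num.min r s by rewrite lt_min r0.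
  have [y [i []]] := sens z _ rs0.
  rewrite frechet_distE lt_min (proximal_dist p) => /andP[zyr zys] _ di.
  have ni : (n <= i)%N.
    by rewrite leqNgt; apply/negP => /sd/(_ zys); rewrite ltNge ltW.
  have [dz|dz] := ltP (d / 2) (N (iter i T z)).
    by exists z; split=> //; exists i.
  exists y; split; first by apply: rV; rewrite fnorm_distC.
  exists i => //; move: di; rewrite iter_linearB.
  by have := fnormB X_frechet (iter i T z) (iter i T y); lra.
have [|x [_ farx]] := baire X_frechet far_open far_dense _ openT.
  by exists 0.
exists x; apply/limn_esup_gt0P; exists (d / 2) => // n.
exact: farx.
Qed.

(** As x = (M + 1) h with h = (h + y) - y, one of y and h + y has an orbit that
    exceeds r' = r / (2 (M + 1)) infinitely often. *)
Lemma proximal_cell_semi_irregular x : dense (proximal_cell p T 0 : set X) ->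
  (0 < limn_esup (fun n => (N (iter n T x))%:E))%E ->
  dense [set y | semi_irregular p T y].
Proof.
move=> prox /limn_esup_gt0P[r r0 xr] V [z Vz] Vopen.
have near_dense : forall n, dense (near_zero n).
  apply: near_zero_dense prox _ => y proxy.
  apply/(einf_near_zeroP T X_frechet); move: proxy.
  rewrite /proximal_cell /proximal /=.
  by under eq_fun do rewrite (proximal_dist0 T X_frechet).
have [d d0 dV] := proj1 (open_fnorm X_frechet V) Vopen z Vz.
have [M Md] := shrink_fnorm x d0.
set h := _ *: x in Md.
have xh : x = h *+ M.+1.
  by rewrite -scaler_nat /h scalerA mulfV ?scale1r// pnatr_eq0.
have [| |y [Vy Vhy] ynear] := generic_translates X_frechet [:: 0; h]
    (O := V `&` [set y | V (h + y)])
    (near_zero_open X_frechet T_continuous) near_dense.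
- apply: openI => //; apply/(open_fnorm X_frechet) => y /= Vhy.
  have [s s0 sV] := proj1 (open_fnorm X_frechet V) Vopen _ Vhy.
  by exists s => // w ws; apply: sV; rewrite [h + w]addrC addrKA.
- by exists z; split=> //=; apply: dV; rewrite addrK.
pose r' := r / (M.+1%:R *+ 2).
have M0 : 0 < M.+1%:R :> R by rewrite ltr0n.
have r'0 : 0 < r' by rewrite divr_gt0// pmulrn_lgt0.
have semi w : (forall n, near_zero n w) ->
    (forall n, exists2 i, (n <= i)%N & r' < N (iter i T w)) ->
    semi_irregular p T w.
  move=> wnear wfar; split; first exact/(einf_near_zeroP T X_frechet).
  by apply/limn_esup_gt0P; exists r'.
(* Either y has the required large iterates, or it is eventually bounded by r'
   and then h + y has them. *)
have [yfar|] := pselect (forall n, exists2 i, (n <= i)%N & r' < N (iter i T y)).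
  exists y; split=> //; apply: semi => // n.
  by have := ynear 0 _ n; rewrite add0r; apply; rewrite mem_head.
move=> /existsNP[n0 ynot].
exists (h + y); split=> //; apply: semi => n.
  by apply: ynear; rewrite !inE eqxx orbT.
have [i ni ri] := xr (maxn n n0); exists i.
  by rewrite (leq_trans _ ni)// leq_maxl.
have yi : N (iter i T y) <= r'.
  rewrite leNgt; apply/negP => ylt; apply: ynot; exists i => //.
  by rewrite (leq_trans _ ni)// leq_maxr.
have : r < M.+1%:R * N (iter i T h).
  by apply: (lt_le_trans ri); rewrite xh iter_linearMn fnormMn.
have -> : r = M.+1%:R * (r' + r').
  by rewrite /r' -mulr2n mulrnAr -mulrnAl mulrC divfK// gt_eqF// pmulrn_lgt0.
rewrite ltr_pM2l// => hi.
have := fnormB X_frechet (iter i T (h + y)) (iter i T y).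
rewrite -iter_linearB addrK; lra.
Qed.

End equivalences.

Theorem theorem3p32 (R : realType) (k : scalar_kind)
    (X : tvsType (scalars R k)) (p : nat -> X -> R) (T : {linear X -> X})
    (X_infinite : infinite_dimensional X) (X_frechet : frechet_space p)
    (T_continuous : continuous T) :
  [<-> exists2 S : set X, dense S & forall x, S x -> semi_irregular p T x;
       exists (m : nat) (S : set X),
         residual S /\ forall x, S x -> irregular p T m x;
       exists m : nat, forall O : nat -> set X,
         (forall j, open (O j) /\ O j !=set0) ->
         exists K : nat -> set X,
           (forall j, cantor_set R (K j) /\ K j `<=` O j) /\
           li_yorke_extremely_scrambled p T m (\bigcup_j K j);
       dense (proximal_relation p T : set (X * X)) /\ sensitive p T;
       dense (proximal_cell p T 0 : set X) /\
         exists x : X,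
           (0 < limn_esup (fun n => (frechet_dist p (iter n T x) 0)%:E))%E].
Proof.
tfae.
- move=> [S Sdense Ssemi].
  exact: (semi_irregular_residual_irregular _ _ Sdense).
- move=> [m [A [Ares Airr]]]; exists m.
  exact: (residual_irregular_scrambled _ _ Ares).
- move=> [m scrambled]; split.
    exact: (scrambled_proximal_dense X_frechet scrambled).
  have [|K [Kcantor Kscr]] := scrambled (fun=> setT).
    by move=> _; split; [exact: openT|exists 0].
  have [x [y [Kx Ky xy]]] := cantor_set_two_points (proj1 (Kcantor 0%N)).
  apply: (extremely_chaotic_sensitive X_frechet (m := m) (x := x) (y := y)).
  by apply: Kscr xy; exists 0%N.
- move=> [prox sens]; split; first exact: proximal_relation_cell_dense.
  exact: sensitive_not_asymptotic sens.
- move=> [prox [x x_gt0]]; exists [set y | semi_irregular p T y] => //.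
  exact: proximal_cell_semi_irregular prox x_gt0.
Qed.
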